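(* Let $q$ be a connected conjunctive query with no unary atoms, let $\tau^*=\tau^*(q)$ be its fractional covering number, and let $\varepsilon<1-1/\tau^*$. Then any deterministic $\mathrm{MPC}(\varepsilon)$ algorithm that runs in one communication round on $p$ servers reports $O\!\left(\mathbf E[|q(I)|]/p^{\tau^*(1-\varepsilon)-1}\right)$ correct answers in expectation, where $I$ is a uniformly random matching database over $[n]$ and the constant in $O(\cdot)$ depends only on $q$ and on the constant in the per-round communication bound.
   Context: Conjunctive queries $q(x_1,\ldots,x_k)=S_1(\bar x_1),\ldots,S_\ell(\bar x_\ell)$ are full and self-join-free, $S_j$ of arity $a_j$; $q$ is connected if its hypergraph (variables as vertices, hyperedge $\mathrm{vars}(S_j)$ per atom) is connected. $\tau^*(q)$ is the minimum of $\sum_iv_i$ over $v_i\ge0$ with $\sum_{i:x_i\in\mathrm{vars}(S_j)}v_i\ge1$ for all $j$. A matching database over $[n]$: each $S_j$ has exactly $n$ tuples and each column contains every value in $[n]$ exactly once; a uniformly random matching database chooses each $S_j$ independently and uniformly among such matchings. $\mathrm{MPC}(\varepsilon)$ model (lower-bound version): $p$ worker servers with unlimited computation; each relation $S_j$ is stored on its own input server, which in the (single) round sends an arbitrary message depending only on $S_j$ to each worker; each worker receives at most $cN/p^{1-\varepsilon}$ bits in total, where $N=O(n\log n)$ is the input size and $c$ a constant. After the round each worker outputs tuples; the algorithm reports a tuple if some worker outputs it, and ''correct answers'' are reported tuples that lie in $q(I)$.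
   Formalization: The algorithm is assumed never to report a tuple outside q(I) (else a worker could output all tuples with no communication); this and the load bound, with N the size of the actual input, are required on all databases over [n], not only matchings, and each atom's variables are distinct. *)

(* Defs.v *)
From Stdlib Require Import Reals.
From HB Require Import structures.
From mathcomp Require Import all_boot all_order all_algebra.
From mathcomp Require Import Rstruct.
Set Implicit Arguments. Unset Strict Implicit. Unset Printing Implicit Defensive.
Import Order.TTheory GRing.Theory Num.Theory.
Local Open Scope ring_scope.

(* A full, self-join-free conjunctive query
     q(x_0,...,x_{k-1}) = S_0(xbar_0), ..., S_{l-1}(xbar_{l-1})
   is given by k (number of variables), l (number of atoms), the arities
   a j, and for each atom j the variable vector xbar_j : 'I_(a j) -> 'I_k.
   Self-join-freeness is built in: every atom j has its own relation S_j. *)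
Section Query.
Variables (k l : nat) (a : 'I_l -> nat) (x : forall j : 'I_l, 'I_(a j) -> 'I_k).

Definition atom_vars (j : 'I_l) : {set 'I_k} := @x j @: 'I_(a j).

Definition query_adj : rel 'I_k :=
  fun u v => [exists j : 'I_l, (u \in atom_vars j) && (v \in atom_vars j)].

Definition connected_query : Prop := forall u v : 'I_k, connect query_adj u v.

Definition no_unary_atoms : Prop := forall j : 'I_l, a j <> 1%N.

Definition distinct_atom_vars : Prop := forall j : 'I_l, injective (@x j).

Definition frac_vertex_cover (v : 'I_k -> R) : Prop :=
  (forall i, 0 <= v i) /\ (forall j : 'I_l, 1 <= \sum_(i in atom_vars j) v i).

Definition is_tau_star (t : R) : Prop :=
  (exists v, frac_vertex_cover v /\ \sum_(i < k) v i = t) /\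
  (forall v, frac_vertex_cover v -> t <= \sum_(i < k) v i).

Definition database (n : nat) :=
  {dffun forall j : 'I_l, {set {ffun 'I_(a j) -> 'I_n}}}.

Definition is_matching (n m : nat) (S : {set {ffun 'I_m -> 'I_n}}) : bool :=
  (#|S| == n) &&
  [forall c : 'I_m, forall w : 'I_n, #|[set t in S | t c == w]| == 1%N].

Definition matching_db (n : nat) (I : database n) : bool :=
  [forall j : 'I_l, is_matching (I j)].

Definition answers (n : nat) (I : database n) : {set {ffun 'I_k -> 'I_n}} :=
  [set t : {ffun 'I_k -> 'I_n} |
     [forall j : 'I_l, [ffun i : 'I_(a j) => t (@x j i)] \in I j]].

(* input size in bits: each of the |S_j| tuples of S_j takes a_j log2 n bits *)
Definition log2 (n : nat) : R := ln (INR n) / ln 2.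
Definition input_bits (n : nat) (I : database n) : R :=
  \sum_(j < l) ((#|I j| * a j)%N%:R * log2 n).

(* msg j s S : the bit string sent by the input server of S_j (which only
   sees S_j) to worker s;  out s m : the tuples output by worker s after
   receiving the messages m j (j < l). *)
Record mpc1_alg (n p : nat) := MPC1 {
  msg : forall j : 'I_l, 'I_p -> {set {ffun 'I_(a j) -> 'I_n}} -> seq bool;
  out : 'I_p -> ('I_l -> seq bool) -> {set {ffun 'I_k -> 'I_n}}
}.

Definition received (n p : nat) (A : mpc1_alg n p) (I : database n) (s : 'I_p)
  : 'I_l -> seq bool := fun j => @msg n p A j s (I j).

Definition reported (n p : nat) (A : mpc1_alg n p) (I : database n)
  : {set {ffun 'I_k -> 'I_n}} := \bigcup_(s < p) out A s (received A I s).

Definition load_ok (n p : nat) (c eps : R) (A : mpc1_alg n p) : Prop :=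
  forall (I : database n) (s : 'I_p),
    (\sum_(j < l) size (received A I s j))%N%:R
      <= c * input_bits I / Rpower p%:R (1 - eps).

Definition sound (n p : nat) (A : mpc1_alg n p) : Prop :=
  forall I : database n, reported A I \subset answers I.

Definition E_matching (n : nat) (f : database n -> nat) : R :=
  (\sum_(I : database n | matching_db I) f I)%N%:R
    / #|[set I : database n | matching_db I]|%:R.

Definition expected_answers (n : nat) : R :=
  E_matching (fun I : database n => #|answers I|).

Definition expected_correct (n p : nat) (A : mpc1_alg n p) : R :=
  E_matching (fun I : database n => #|reported A I :&: answers I|).

End Query.

(* Main.v *)
Require Import Defs.
From Stdlib Require Import Reals Classical FunctionalExtensionality.
From HB Require Import structures.
From mathcomp Require Import all_boot all_order all_algebra all_fingroup.
From mathcomp Require Import Rstruct ring lra zify.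
Import Order.TTheory GRing.Theory Num.Theory.
Set Implicit Arguments.
Unset Strict Implicit.
Unset Printing Implicit Defensive.
Local Open Scope ring_scope.

(** A worker that has received the messages m_j can, by soundness, output t only if
    every projection t_j belongs to the set K_j of tuples common to all matchings S_j
    with message m_j. Exactly (n - |K|)!^(a_j - 1) matchings contain a given partial
    matching K, so revealing a fraction f of the tuples costs at least f times the
    entropy of S_j, and the load bound gives E|K_j| <= d n with d = O(p^(eps - 1)).
    The relations are independent, so the expected number of answers of one worker is at
    most the sum over t of the products of P(t_j in K_j). Normalised by P(t_j in S_j) the
    factors lie in [0,1] and have mean at most d; a fractional edge packing u of total
    weight tau, which exists by linear programming duality, and Friedgut's inequality
    bound the sum by O(d^tau) E|q(I)|. Summing over the p workers gives the theorem. *)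

(** * Logarithms and powers *)

Lemma ln_le_subr1 (y : R) : 0 < y -> ln y <= y - 1.
Proof.
move=> /RltP y0; rewrite lerBrDl; apply/RleP.
by have := exp_ineq1_le (ln y); rewrite exp_ln.
Qed.

Lemma lnM (y z : R) : 0 < y -> 0 < z -> ln (y * z)%R = ln y + ln z.
Proof. by move=> /RltP y0 /RltP z0; exact: ln_mult. Qed.

Lemma lnV (y : R) : 0 < y -> ln y^-1%R = - ln y.
Proof. by move=> /RltP y0; exact: ln_Rinv. Qed.

Lemma ln1 : ln 1%R = 0.
Proof. exact: ln_1. Qed.

Lemma ler_ln (y z : R) : 0 < y -> y <= z -> ln y <= ln z.
Proof.
move=> y0; rewrite le_eqVlt => /orP[/eqP->//|/RltP yz]; apply/RleP.
by left; apply: ln_increasing => //; apply/RltP.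
Qed.

Lemma lnX (y : R) (m : nat) : 0 < y -> ln (y ^+ m)%R = m%:R * ln y.
Proof.
move=> y0; elim: m => [|m IH]; first by rewrite expr0 ln1 mul0r.
by rewrite exprS lnM ?exprn_gt0 // IH -natr1 mulrDl mul1r addrC.
Qed.

Lemma exp_gt0 (y : R) : 0 < exp y.
Proof. by apply/RltP; exact: exp_pos. Qed.

Lemma ler_exp (y z : R) : y <= z -> exp y <= exp z.
Proof.
rewrite le_eqVlt => /orP[/eqP->//|/RltP yz]; apply/RleP.
by left; exact: exp_increasing.
Qed.

Lemma RpowerE (y z : R) : Rpower y z = exp (z * ln y)%R.
Proof. by []. Qed.

Lemma Rpower_gt0 (y z : R) : 0 < Rpower y z.
Proof. exact: exp_gt0. Qed.

Lemma Rpower0 (y : R) : Rpower y 0%R = 1.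
Proof. by rewrite RpowerE mul0r expR0. Qed.

Lemma Rpower1 (y : R) : 0 < y -> Rpower y 1%R = y.
Proof. by move=> /RltP; exact: Rpower_1. Qed.

Lemma RpowerD (y z w : R) : Rpower y (z + w)%R = Rpower y z * Rpower y w.
Proof. exact: Rpower_plus. Qed.

Lemma RpowerN (y z : R) : Rpower y (- z)%R = (Rpower y z)^-1.
Proof. exact: Rpower_Ropp. Qed.

Lemma Rpower_powM (y z w : R) : Rpower (Rpower y z) w = Rpower y (z * w)%R.
Proof. exact: Rpower_mult. Qed.

Lemma RpowerM (y z w : R) : 0 < y -> 0 < z ->
  Rpower (y * z)%R w = Rpower y w * Rpower z w.
Proof. by move=> y0 z0; rewrite !RpowerE lnM // mulrDr expRD. Qed.

Lemma RpowerV (y w : R) : 0 < y -> Rpower y^-1%R w = (Rpower y w)^-1.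
Proof. by move=> y0; rewrite -RpowerN !RpowerE lnV // mulrN mulNr. Qed.

Lemma ler_Rpower (y z w : R) : 0 <= w -> 0 < y -> y <= z ->
  Rpower y w <= Rpower z w.
Proof. by move=> w0 y0 yz; rewrite ler_exp // ler_wpM2l // ler_ln. Qed.

Lemma Rpower_ge1 (y w : R) : 1 <= y -> 0 <= w -> 1 <= Rpower y w.
Proof.
by move=> y1 w0; rewrite -expR0 RpowerE ler_exp // mulr_ge0 // -ln1 ler_ln.
Qed.

(** Lets a weight in (0, 1] be bounded by its power with an exponent at most 1, the form required by
    [friedgut]. *)
Lemma Rpower_ge_base (y w : R) : 0 < y -> y <= 1 -> w <= 1 -> y <= Rpower y w.
Proof.
move=> y0 y1 w1; rewrite -[leLHS]Rpower1 // ler_exp //.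
by rewrite ler_wnM2r // -ln1 ler_ln.
Qed.

Lemma prod_Rpower (I : finType) (y : R) (w : I -> R) :
  \prod_i Rpower y (w i) = Rpower y (\sum_i w i).
Proof.
by rewrite (big_morph (Rpower y) (RpowerD y) (Rpower0 y)).
Qed.

Lemma exp_sum (I : finType) (F : I -> R) : exp (\sum_i F i) = \prod_i exp (F i).
Proof.
by rewrite (big_morph exp (fun y z => esym (expRD y z)) expR0).
Qed.

(** * Linear programming duality *)

(* Bartl's induction: a point violating the implication without the first
   functional is used to project that functional away. *)
Lemma farkas (F : realFieldType) (V : lmodType F) (T : eqType) (s : seq T)
    (al : T -> V -> F) (ga : V -> F) :
  uniq s -> (forall i, scalar (al i)) -> scalar ga ->
  (forall y, (forall i, i \in s -> 0 <= al i y) -> 0 <= ga y) ->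
  exists u : T -> F, (forall i, 0 <= u i) /\
    forall y, ga y = \sum_(i <- s) u i * al i y.
Proof.
elim: s al ga => [|i s IH] al ga /=.
  move=> _ _ lga hga; exists (fun _ => 0); split=> // y; rewrite big_nil.
  have ga0 : ga 0 = 0.
    by have := lga 1 0 0; rewrite scale1r addr0 mul1r; lra.
  have gaN : ga (- y) = - ga y.
    by have := lga (-1) y 0; rewrite addr0 ga0 scaleN1r; lra.
  have := hga y (fun _ h => False_ind _ (elimF idP (in_nil _) h)).
  have := hga (- y) (fun _ h => False_ind _ (elimF idP (in_nil _) h)).
  by rewrite gaN; lra.
move=> /andP[i_s us] lal lga hga.
have [h|h] := classic
  (forall y, (forall j, j \in s -> 0 <= al j y) -> 0 <= ga y).
  have [u [u0 uE]] := IH al ga us lal lga h.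
  exists (fun j => if j == i then 0 else u j); split; first by move=> j; case: ifP.
  move=> y; rewrite big_cons eqxx mul0r add0r uE.
  apply: eq_big_seq => j js.
  by case: eqP => // ji; rewrite -ji js in i_s.
have [z hz] := not_all_ex_not _ _ h.
have [zs /negP] := imply_to_and _ _ hz; rewrite -ltNge => gz.
have iz : al i z < 0.
  rewrite ltNge; apply/negP => iz; suff : 0 <= ga z by lra.
  by apply: hga => j; rewrite inE => /orP[/eqP->//|]; exact: zs.
have lD (f : V -> F) : scalar f -> forall y c, f (y - c *: z) = f y - c * f z.
  by move=> lf y c; rewrite addrC -scaleNr lf addrC mulNr.
pose pr y := y - (al i y / al i z) *: z.
have iz0 : al i z != 0 by lra.
have pri y : al i (pr y) = 0 by rewrite lD // divfK // subrr.
have lpr (f : V -> F) : scalar f -> scalar (f \o pr).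
  move=> lf c y w /=; rewrite /pr !lD // lf lal; field.
  exact: iz0.
have [||y hy|u [u0 uE]] := IH (fun j => al j \o pr) (ga \o pr) us.
- by move=> j; exact: lpr.
- exact: lpr.
- apply: hga => j; rewrite inE => /orP[/eqP->|js]; first by rewrite pri.
  exact: hy.
(* The coefficient of [al i] is forced by evaluating the desired identity at [z]. Numerator and
   denominator are both negative, so it is nonnegative. *)
pose v := (ga z - \sum_(j <- s) u j * al j z) / al i z.
exists (fun j => if j == i then v else u j); split.
  move=> j; case: eqP => // _; rewrite /v.
  have : 0 <= \sum_(j <- s) u j * al j z.
    rewrite big_seq; apply: sumr_ge0 => j' js; rewrite mulr_ge0 //.
    exact: zs.
  move=> h0; rewrite -mulrNN mulr_ge0 //; first by lra.
  by rewrite -invrN invr_ge0; lra.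
move=> y; rewrite big_cons eqxx.
have -> : \sum_(j <- s) (if j == i then v else u j) * al j y
    = \sum_(j <- s) u j * al j y.
  apply: eq_big_seq => j js.
  by case: eqP => // ji; rewrite -ji js in i_s.
have := uE y; rewrite /= /pr lD // => /eqP; rewrite subr_eq => /eqP ->.
have -> : \sum_(j <- s) u j * al j (y - (al i y / al i z) *: z) =
    \sum_(j <- s) u j * al j y
      - (al i y / al i z) * \sum_(j <- s) u j * al j z.
  rewrite mulr_sumr -sumrB; apply: eq_bigr => j _; rewrite lD //; ring.
rewrite /v; field; exact: iz0.
Qed.

(** [farkas] is applied to the homogenised cover problem on pairs (v, h): nonnegative v with weight
    at least h on every atom have total weight at least tau h. The multipliers of the atom
    constraints form the packing [u]. *)
Lemma tau_star_edge_packing (k l : nat) (a : 'I_l -> nat)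
    (x : forall j : 'I_l, 'I_(a j) -> 'I_k) (tau : R) :
  is_tau_star x tau ->
  exists u : 'I_l -> R, [/\ forall j, 0 <= u j,
    forall i, \sum_(j | i \in atom_vars x j) u j <= 1 & \sum_j u j = tau].
Proof.
move=> [[v0 [[v00 _] v0E]] tmin].
pose V := ('rV[R]_k * R^o)%type.
pose al (q : 'I_k + 'I_l) (y : V) : R := match q with
  | inl i => y.1 0 i
  | inr j => \sum_(i in atom_vars x j) y.1 0 i - y.2 end.
pose ga (y : V) : R := \sum_i y.1 0 i - tau * y.2.
have tau0 : 0 <= tau by rewrite -v0E sumr_ge0.
have lal q : scalar (al q).
  case: q => [i|j] c y z /=; first by rewrite !mxE.
  rewrite mulrBr mulr_sumr opprD addrACA -big_split /=; congr (_ + _).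
  by apply: eq_bigr => i _; rewrite !mxE.
have lga : scalar ga.
  move=> c y z; rewrite /ga /= (_ : \sum_i _ = c * \sum_i y.1 0 i + \sum_i z.1 0 i).
    by rewrite /GRing.scale /=; ring.
  by rewrite mulr_sumr -big_split /=; apply: eq_bigr => i _; rewrite !mxE.
have [y hy|u [u0 uE]] := farkas (index_enum_uniq _) lal lga.
  have hv i : 0 <= y.1 0 i by apply: (hy (inl i)); rewrite mem_index_enum.
  have hj j : y.2 <= \sum_(i in atom_vars x j) y.1 0 i.
    by have := hy (inr j) (mem_index_enum _); rewrite /= subr_ge0.
  (* For positive [y.2], dividing by it gives a fractional cover and minimality of [tau] applies;
     otherwise [tau * y.2] is at most 0. *)
  rewrite /ga subr_ge0; have [y2|y2] := ltP 0 (y.2 : R); last first.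
    by apply: (le_trans (y := 0)); rewrite ?sumr_ge0 // mulr_ge0_le0.
  rewrite -ler_pdivlMr // mulr_suml; apply: tmin; split=> [i|j].
    by rewrite divr_ge0 // ltW.
  by rewrite -mulr_suml ler_pdivlMr // mul1r.
have uE' y : ga y = \sum_i u (inl i) * al (inl i) y
    + \sum_j u (inr j) * al (inr j) y by rewrite uE big_sumType.
exists (u \o inr); split=> [j|i|] /=; first exact: u0.
(* At the i-th unit vector the identity reads 1 = [u (inl i)] + (packing sum at i), so the
   multiplier of the sign constraint is the slack. The point (0, 1) later yields the total
   weight. *)
- have := uE' (delta_mx 0 i, 0); rewrite /ga /al /= mulr0 subr0.
  rewrite (bigD1 i) //= mxE !eqxx big1 => [|i' /negbTE ii']; last first.
    by rewrite mxE eqxx ii'.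
  rewrite (bigD1 i) //= mxE !eqxx big1 => [|i' /negbTE ii']; last first.
    by rewrite mxE eqxx ii' mulr0.
  rewrite !addr0 !mulr1.
  rewrite (_ : \sum_j _ = \sum_(j | i \in atom_vars x j) u (inr j)).
    by have := u0 (inl i); lra.
  rewrite [RHS]big_mkcond; apply: eq_bigr => j _; rewrite subr0.
  case: ifP => ij; last first.
    rewrite big1 ?mulr0 // => i' ij'; rewrite mxE eqxx /=; case: eqP => // e.
    by rewrite -e ij' in ij.
  rewrite (bigD1 i) //= mxE !eqxx big1 ?addr0 ?mulr1 // => i'.
  by move=> /andP[_ /negbTE ii']; rewrite mxE ii' andbF.
- have := uE' (0, 1); rewrite /ga /al /=.
  rewrite big1 => [|i _]; last by rewrite mxE.
  rewrite [X in _ = X + _]big1 => [|i _]; last by rewrite mxE mulr0.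
  rewrite (_ : \sum_j u (inr j) * _ = - \sum_j u (inr j)); first by lra.
  rewrite -sumrN; apply: eq_bigr => j _.
  by rewrite big1 ?sub0r ?mulrN1 // => i _; rewrite mxE.
Qed.

(** * A Hoelder-type inequality for hypergraphs *)

(** The missing weight [1 - \sum_j u j] is carried by an extra term equal to 1. With [A] the
    right-hand side, the bound follows from [ln z <= z - 1] at each [y j / A] and at [A^-1]. *)
Lemma weighted_amgm (J : finType) (u y : J -> R) :
  (forall j, 0 <= u j) -> \sum_j u j <= 1 -> (forall j, 0 < y j) ->
  \prod_j Rpower (y j) (u j) <= \sum_j u j * y j + (1 - \sum_j u j).
Proof.
move=> u0 u1 y0; set A := (X in _ <= X).
have [uz|unz] := eqVneq (\sum_j u j) 0.
  have u00 j : u j = 0.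
    apply/eqP; move/eqP: uz; rewrite psumr_eq0 // => /allP.
    by apply; exact: mem_index_enum.
  rewrite big1 => [|j _]; last by rewrite u00 Rpower0.
  by rewrite /A uz big1 ?add0r ?subr0 // => j _; rewrite u00 mul0r.
have A0 : 0 < A.
  have [j uj] : exists j, 0 < u j.
    apply: NNPP => h; case/eqP: unz; apply: big1 => j _; apply/eqP.
    by rewrite eq_le u0 andbT leNgt; apply/negP => uj; apply: h; exists j.
  rewrite ltr_pwDl ?subr_ge0 // (bigD1 j) //= ltr_pwDl ?mulr_gt0 //.
  by apply: sumr_ge0 => i _; rewrite mulr_ge0 // ltW.
have -> : \prod_j Rpower (y j) (u j) = exp (\sum_j u j * ln (y j)).
  by rewrite exp_sum.
suff h : \sum_j u j * ln (y j) <= ln A.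
  by apply: (le_trans (ler_exp h)); rewrite exp_ln //; apply/RltP.
have lnj j : u j * ln (y j) <= u j * ln A + (u j * y j) / A - u j.
  have : ln (y j / A) <= y j / A - 1 by rewrite ln_le_subr1 // divr_gt0.
  rewrite lnM ?invr_gt0 // lnV // => h.
  rewrite (_ : _ - u j = u j * (ln A + (y j / A - 1))); last by ring.
  by rewrite ler_wpM2l //; lra.
(* This is the contribution of the extra term of value 1. *)
have lnA : ln A^-1%R <= A^-1 - 1 by rewrite ln_le_subr1 // invr_gt0.
rewrite lnV // in lnA.
apply: (le_trans (ler_sum _ (fun j _ => lnj j))).
rewrite sumrB big_split /= -!mulr_suml.
have -> : \sum_j u j * y j = A - (1 - \sum_j u j) by rewrite /A; ring.
have h1 : 0 <= (1 - \sum_j u j) * (A^-1 - 1 + ln A) by rewrite mulr_ge0; lra.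
have e : (A - (1 - \sum_j u j)) / A = 1 - (1 - \sum_j u j) / A.
  by field; rewrite gt_eqF.
rewrite e; set U := \sum_j u j in h1 *; set z := ln A in h1 *.
have := h1; rewrite mulrDr mulrBr mulr1; lra.
Qed.

Section Averaging.
Variables (k n : nat).
Implicit Types (t : {ffun 'I_k -> 'I_n}) (g : {ffun 'I_k -> 'I_n} -> R).

Definition upd t (i : 'I_k) (w : 'I_n) : {ffun 'I_k -> 'I_n} :=
  [ffun i' => if i' == i then w else t i'].

Definition avg (i : 'I_k) g t : R := ((\sum_w g (upd t i w)) / n%:R)%R.

Definition indep (i : 'I_k) g := forall t w, g (upd t i w) = g t.

Lemma upd_id t i : upd t i (t i) = t.
Proof. by apply/ffunP => i'; rewrite ffunE; case: eqP => // ->. Qed.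

Lemma upd_upd t i w w' : upd (upd t i w) i w' = upd t i w'.
Proof. by apply/ffunP => i'; rewrite !ffunE; case: eqP. Qed.

Lemma updC t i i' w w' : i != i' -> upd (upd t i w) i' w' = upd (upd t i' w') i w.
Proof.
move=> ii'; apply/ffunP => i''; rewrite !ffunE.
by case: eqP => // ->; rewrite eq_sym (negbTE ii').
Qed.

Lemma dim_gt0 t (i : 'I_k) : (0 < n)%N.
Proof. by case: (t i) => w; apply: leq_ltn_trans. Qed.

Lemma avg_gt0 i g : (forall t, 0 < g t) -> forall t, 0 < avg i g t.
Proof.
move=> g0 t; rewrite divr_gt0 ?ltr0n ?(dim_gt0 t i) //.
rewrite (bigD1 (t i)) //= ltr_pwDl // sumr_ge0 // => w _; exact: ltW.
Qed.

Lemma avg_indep i g : indep i g -> forall t, avg i g t = g t.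
Proof.
move=> gi t; rewrite /avg (eq_bigr (fun=> g t)) => [|w _]; last exact: gi.
rewrite sumr_const card_ord -(mulr_natr (g t)) mulfK //.
by rewrite pnatr_eq0 -lt0n (dim_gt0 t i).
Qed.

Lemma indep_avg i g : indep i (avg i g).
Proof. by move=> t w; rewrite /avg; under eq_bigr do rewrite upd_upd. Qed.

Lemma indep_avg_other i i' g : indep i g -> indep i (avg i' g).
Proof.
move=> gi; have [<-|ii'] := eqVneq i i'; first exact: indep_avg.
move=> t w; rewrite /avg; congr (_ / _).
by apply: eq_bigr => w' _; rewrite updC // gi.
Qed.

Lemma sum_avg i g : \sum_t avg i g t = \sum_t g t.
Proof.
have [/eqP n0|n0] := posnP n.
  by apply: eq_bigr => t _; have := dim_gt0 t i; rewrite (eqP n0).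
rewrite -mulr_suml.
rewrite (pair_bigA _ (fun t w => g (upd t i w))) /=.
(* The map exchanges [t i] with [w], so it is an involution on pairs. *)
rewrite (reindex (fun q : {ffun 'I_k -> 'I_n} * 'I_n => (upd q.1 i q.2, q.1 i))) /=.
  rewrite (eq_bigr (fun q => g q.1)) => [|[t w] _]; last first.
    by rewrite upd_upd upd_id.
  rewrite -(pair_bigA _ (fun t (w : 'I_n) => g t)) /= mulr_suml.
  apply: eq_bigr => t _; rewrite sumr_const card_ord -(mulr_natr (g t)) mulfK //.
  by rewrite pnatr_eq0 -lt0n.
exists (fun q : {ffun 'I_k -> 'I_n} * 'I_n => (upd q.1 i q.2, q.1 i)) => -[t w] _ /=;
  by rewrite upd_upd upd_id ffunE eqxx.
Qed.

Lemma foldr_avg_gt0 s g : (forall t, 0 < g t) -> forall t, 0 < foldr avg g s t.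
Proof. by move=> g0; elim: s => //= i s IH; exact: avg_gt0. Qed.

Lemma sum_foldr_avg s g : \sum_t foldr avg g s t = \sum_t g t.
Proof. by elim: s => //= i s IH; rewrite sum_avg. Qed.

Lemma indep_foldr_avg i s g : indep i g -> indep i (foldr avg g s).
Proof. by move=> gi; elim: s => //= i' s; exact: indep_avg_other. Qed.

Lemma indep_foldr_avg_mem i s g : i \in s -> indep i (foldr avg g s).
Proof.
elim: s => //= i' s IH; rewrite inE => /orP[/eqP->|/IH]; first exact: indep_avg.
exact: indep_avg_other.
Qed.

Lemma indep_const g : (forall i, indep i g) -> forall t t', g t = g t'.
Proof.
move=> gi t t'.
have h (s : seq 'I_k) : g [ffun i => if i \in s then t' i else t i] = g t.
  elim: s => [|i s IH]; first by congr g; apply/ffunP => i; rewrite ffunE.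
  rewrite -IH -[RHS](gi i _ (t' i)); congr g; apply/ffunP => i'.
  by rewrite !ffunE inE; case: eqP => //= ->.
rewrite -(h (enum 'I_k)); congr g; apply/ffunP => i.
by rewrite ffunE mem_enum.
Qed.

(** Averaging over every coordinate leaves a constant, and it preserves the total, so that constant
    is the mean. *)
Lemma foldr_avg_enum g t :
  foldr avg g (enum 'I_k) t = (\sum_t' g t') / (n ^ k)%N%:R.
Proof.
have c := indep_const (fun i => indep_foldr_avg_mem g (mem_enum _ i)).
rewrite -(sum_foldr_avg (enum 'I_k)) (eq_bigr _ (fun t' _ => c t' t)).
rewrite sumr_const card_ffun !card_ord -(mulr_natr (foldr _ _ _ t)) mulfK //.
rewrite pnatr_eq0 -lt0n expn_gt0.
by case: k t {c} => [|k'] t; rewrite ?orbT //; case: (t ord0) => w; case: n.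
Qed.

Section Friedgut.
Variables (J : finType) (u : J -> R) (e : J -> {set 'I_k}).
Hypothesis u_ge0 : forall j, 0 <= u j.
Hypothesis u_packing : forall i, \sum_(j | i \in e j) u j <= 1.

(** Each [G j] is divided by its average along [i]. Weighted AM-GM bounds the product of powers of
    these ratios, and every ratio averages to 1, so the bound averages to 1. *)
Lemma avg_holder i (G : J -> {ffun 'I_k -> 'I_n} -> R) t :
  (forall j t, 0 < G j t) -> (forall j, i \notin e j -> indep i (G j)) ->
  avg i (fun t => \prod_j Rpower (G j t) (u j)) t
    <= \prod_j Rpower (avg i (G j) t) (u j).
Proof.
move=> G0 Gi; have n0 := dim_gt0 t i.
have a0 j : 0 < avg i (G j) t by exact: avg_gt0.
have P0 : 0 < \prod_j Rpower (avg i (G j) t) (u j).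
  by apply: prodr_gt0 => j _; exact: Rpower_gt0.
rewrite /avg ler_pdivrMr ?ltr0n // -ler_pdivrMl // mulr_sumr.
(* For the [j] whose edge avoids [i] the ratio equals 1, so its exponent may be set to 0; the
   remaining exponents sum to at most 1 by the packing condition at [i]. *)
pose u' j := if i \in e j then u j else 0.
have u'0 j : 0 <= u' j by rewrite /u'; case: ifP.
have u'1 : \sum_j u' j <= 1 by rewrite -big_mkcond.
have h w : (\prod_j Rpower (avg i (G j) t) (u j))^-1
      * \prod_j Rpower (G j (upd t i w)) (u j)
    <= \sum_j u' j * (G j (upd t i w) / avg i (G j) t) + (1 - \sum_j u' j).
  have -> : (\prod_j Rpower (avg i (G j) t) (u j))^-1
      * \prod_j Rpower (G j (upd t i w)) (u j)
    = \prod_j Rpower (G j (upd t i w) / avg i (G j) t)%R (u' j).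
    rewrite -prodfV -big_split /=; apply: eq_bigr => j _.
    rewrite -RpowerV // mulrC -RpowerM ?invr_gt0 // /u'.
    case: ifP => // /negbT/Gi gi.
    by rewrite gi avg_indep // divff ?gt_eqF // Rpower0 RpowerE ln1 mulr0 expR0.
  by apply: weighted_amgm => // j; rewrite divr_gt0.
apply: (le_trans (ler_sum _ (fun w _ => h w))).
rewrite big_split /= exchange_big /= sumr_const card_ord.
have -> : \sum_j \sum_w u' j * (G j (upd t i w) / avg i (G j) t)
    = \sum_j u' j * n%:R.
  apply: eq_bigr => j _; rewrite -mulr_sumr -mulr_suml; congr (_ * _).
  have := a0 j; rewrite /avg; set S := \sum_w _ => S0.
  have nn : (n%:R : R) != 0 by rewrite pnatr_eq0 -lt0n.
  have : S != 0 by apply: contraTneq S0 => ->; rewrite mul0r ltxx.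
  by move=> Sn; field; rewrite Sn nn.
by rewrite -mulr_suml -(mulr_natr (1 - _)) -mulrDl addrC subrK mul1r.
Qed.

(** Coordinates are averaged out one by one: [sum_avg] keeps the sum, [avg_holder] only enlarges the
    integrand. In the end each [G j] has become its mean. *)
Lemma friedgut (G : J -> {ffun 'I_k -> 'I_n} -> R) :
  (forall j t, 0 < G j t) -> (forall j i, i \notin e j -> indep i (G j)) ->
  \sum_t \prod_j Rpower (G j t) (u j)
    <= (n ^ k)%N%:R * \prod_j Rpower ((\sum_t G j t) / (n ^ k)%N%:R)%R (u j).
Proof.
move=> G0 Gi.
have h s : \sum_t \prod_j Rpower (G j t) (u j)
    <= \sum_t \prod_j Rpower (foldr avg (G j) s t) (u j).
  elim: s => //= i s IH; apply: (le_trans IH).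
  rewrite -(sum_avg i); apply: ler_sum => t _; apply: avg_holder.
    by move=> j; exact: foldr_avg_gt0.
  by move=> j ij; apply: indep_foldr_avg; exact: Gi.
apply: (le_trans (h (enum 'I_k))).
set c := \prod_j _; rewrite (_ : \sum_t _ = \sum_(t : {ffun 'I_k -> 'I_n}) c).
  by rewrite sumr_const card_ffun !card_ord mulr_natl.
by apply: eq_bigr => t _; apply: eq_bigr => j _; rewrite foldr_avg_enum.
Qed.

End Friedgut.
End Averaging.

(** * Counting matchings *)

Lemma is_matchingP n m (S : {set {ffun 'I_m -> 'I_n}}) :
  is_matching S -> forall c w, exists t, [/\ t \in S, t c = w &
    forall t', t' \in S -> t' c = w -> t' = t].
Proof.
move=> /andP[_ /forallP h] c w; have /forallP/(_ w)/cards1P[t tE] := h c.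
exists t.
have : t \in [set t0 in S | t0 c == w] by rewrite tE set11.
rewrite inE => /andP[tS /eqP tc]; split=> // t' t'S t'c.
by apply/set1P; rewrite -tE inE t'S t'c eqxx.
Qed.

Section MatchingCount.
Variables (n b : nat).
Implicit Types (s : {ffun 'I_b -> 'S_n}) (K : {set {ffun 'I_b.+1 -> 'I_n}}).

(** Encodes a matching of arity [b.+1] by [b] permutations: column 0 indexes the tuples and each
    other column is a permutation of it. *)
Definition graph_tuple s (w : 'I_n) : {ffun 'I_b.+1 -> 'I_n} :=
  [ffun c => if unlift ord0 c is Some c' then s c' w else w].

Definition graph_of s : {set {ffun 'I_b.+1 -> 'I_n}} := graph_tuple s @: 'I_n.

Lemma graph_tuple0 s w : graph_tuple s w ord0 = w.
Proof. by rewrite ffunE unlift_none. Qed.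

Lemma graph_tuple_lift s w c : graph_tuple s w (lift ord0 c) = s c w.
Proof. by rewrite ffunE liftK. Qed.

Lemma graph_tuple_inj s c : injective (fun w => graph_tuple s w c).
Proof.
move=> w w'; rewrite /graph_tuple !ffunE; case: unliftP => [c' _|//].
exact: perm_inj.
Qed.

Lemma graph_of_matching s : is_matching (graph_of s).
Proof.
apply/andP; split.
  rewrite card_imset ?card_ord // => w w' /ffunP/(_ ord0).
  by rewrite !graph_tuple0.
apply/forallP => c; apply/forallP => w; apply/cards1P.
have [f _ fK] := injF_bij (@graph_tuple_inj s c).
exists (graph_tuple s (f w)); apply/setP => t; rewrite !inE.
apply/andP/eqP => [[/imsetP[w' _ ->] /eqP]|->].
  by rewrite -[w in _ = w -> _]fK => /graph_tuple_inj ->.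
by rewrite imset_f ?inE // fK.
Qed.

Lemma mem_graph_of s t : (t \in graph_of s) = (t == graph_tuple s (t ord0)).
Proof.
apply/imsetP/eqP => [[w _ ->]|->]; first by rewrite graph_tuple0.
by exists (t ord0); rewrite ?graph_tuple0.
Qed.

Lemma graph_of_inj : injective graph_of.
Proof.
move=> s s' e; apply/ffunP => c; apply/permP => w.
have : graph_tuple s w \in graph_of s' by rewrite -e imset_f.
rewrite mem_graph_of graph_tuple0 => /eqP/ffunP/(_ (lift ord0 c)).
by rewrite !graph_tuple_lift.
Qed.

(** Column 0 takes each value once, so it indexes the tuples; the same property of any other column
    makes that column a permutation. *)
Lemma matching_graph_of (S : {set {ffun 'I_b.+1 -> 'I_n}}) :
  is_matching S -> exists s, S = graph_of s.
Proof.
move=> /is_matchingP h.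
have [f fP] := fin_all_exists (h ord0).
have f_inj c : injective (fun w => f w (lift ord0 c)).
  move=> w w' e; have [t [_ _ tu]] := h (lift ord0 c) (f w (lift ord0 c)).
  have [fS f0 _] := fP w; have [fS' f0' _] := fP w'.
  by rewrite -f0 -f0' (tu (f w)) // -(tu (f w')).
exists [ffun c => perm (f_inj c)]; apply/setP => t; rewrite mem_graph_of.
have gE w : graph_tuple [ffun c => perm (f_inj c)] w = f w.
  apply/ffunP => c; rewrite ffunE; have [fS f0 _] := fP w.
  by case: unliftP => [c' ->|->]; rewrite ?ffunE ?permE.
rewrite gE; have [fS f0 fu] := fP (t ord0).
by apply/idP/eqP => [tS|->//]; rewrite -(fu t).
Qed.

(** Containing [K] prescribes each of the [b] permutations on the set [D] of first entries of [K],
    independently of one another; [D] has as many elements as [K]. *)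
Lemma card_matchings_supset_succ K (S0 : {set {ffun 'I_b.+1 -> 'I_n}}) :
  is_matching S0 -> K \subset S0 ->
  #|[set S : {set {ffun 'I_b.+1 -> 'I_n}} | is_matching S && (K \subset S)]|
    = ((n - #|K|)`! ^ b)%N.
Proof.
move=> /matching_graph_of[s0 ->] KS.
pose D := [set t ord0 | t : {ffun 'I_b.+1 -> 'I_n} in K].
have tK t : t \in K -> t = graph_tuple s0 (t ord0).
  by move=> /(subsetP KS); rewrite mem_graph_of => /eqP.
have cD : #|D| = #|K|.
  by apply: card_in_imset => t t' /tK -> /tK ->; rewrite !graph_tuple0 => ->.
pose Fam (c : 'I_b) : pred 'S_n := [pred q : 'S_n | [forall w in D, q w == s0 c w]].
have -> : [set S : {set {ffun 'I_b.+1 -> 'I_n}} | is_matching S && (K \subset S)]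
    = graph_of @: [set s : {ffun 'I_b -> 'S_n} | s \in family Fam].
  apply/setP => S; rewrite inE; apply/andP/imsetP => [[mS KS']|[s sF ->]].
    have [s sE] := matching_graph_of mS; exists s => //; rewrite inE.
    apply/familyP => c; apply/forall_inP => w /imsetP[t tin ->].
    have /(subsetP KS') := tin; rewrite sE mem_graph_of.
    move=> /eqP/ffunP/(_ (lift ord0 c)); rewrite graph_tuple_lift => <-.
    by rewrite {1}(tK t tin) graph_tuple_lift.
  split; first exact: graph_of_matching.
  apply/subsetP => t tin; rewrite mem_graph_of.
  rewrite {1}(tK _ tin); apply/eqP/ffunP => c; rewrite !ffunE.
  case: unliftP => // c' _; move: sF; rewrite inE => /familyP/(_ c')/forall_inP.
  by move=> /(_ (t ord0) (imset_f _ tin))/eqP.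
rewrite card_imset; last exact: graph_of_inj.
rewrite cardsE card_family.
have cF c : #|Fam c| = (n - #|K|)`!.
  have -> : #|Fam c| = #|[set q : 'S_n | perm_on (~: D) q]|.
    (* Composing with the inverse of [s0 c] turns agreement with [s0 c] on [D] into fixing [D]
       pointwise. *)
    rewrite -(card_preimset _ (@mulIg _ (s0 c)^-1%g)) -cardsE.
    apply: eq_card => q; rewrite !inE.
    apply/forall_inP/subsetP => [h w|h w wD].
      rewrite !inE; apply: contra => /h/eqP.
      by rewrite permM => ->; rewrite permK.
    apply/eqP; apply: (@perm_inj _ (s0 c)^-1%g); rewrite permK.
    apply/eqP; apply: contraT => ne; have := h w.
    by rewrite !inE wD permM => /(_ ne).
  by rewrite cardsE card_perm cardsCs setCK card_ord cD.
rewrite foldrE big_image (eq_bigr (fun=> (n - #|K|)`!)) => [|c _]; last exact: cF.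
by rewrite prod_nat_const card_ord.
Qed.

End MatchingCount.

Lemma card_matchings_supset n m (K S0 : {set {ffun 'I_m -> 'I_n}}) :
  (0 < m)%N -> is_matching S0 -> K \subset S0 ->
  #|[set S : {set {ffun 'I_m -> 'I_n}} | is_matching S && (K \subset S)]|
    = ((n - #|K|)`! ^ m.-1)%N.
Proof. by case: m K S0 => // b K S0 _; exact: card_matchings_supset_succ. Qed.

Definition all_matchings n m : {set {set {ffun 'I_m -> 'I_n}}} :=
  [set S | is_matching S].

Lemma card_all_matchings n m : (0 < m)%N -> #|all_matchings n m| = (n`! ^ m.-1)%N.
Proof.
case: m => // b _; pose s : {ffun 'I_b -> 'S_n} := [ffun=> 1%g].
have := card_matchings_supset_succ (graph_of_matching s) (sub0set _).
by rewrite cards0 subn0 => <-; apply: eq_card => S; rewrite !inE sub0set andbT.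
Qed.

Lemma card_matchings_mem n m (t : {ffun 'I_m -> 'I_n}) : (0 < m)%N ->
  #|[set S : {set {ffun 'I_m -> 'I_n}} | is_matching S && (t \in S)]|
    = (n.-1`! ^ m.-1)%N.
Proof.
case: m t => // b t _.
(* Each transposition sends the first entry of [t] to another of its entries, so the resulting
   matching contains [t]. *)
pose s : {ffun 'I_b -> 'S_n} := [ffun c => tperm (t ord0) (t (lift ord0 c))].
have ts : [set t] \subset graph_of s.
  rewrite sub1set mem_graph_of; apply/eqP/ffunP => c.
  by rewrite ffunE; case: unliftP => [c' ->|->//]; rewrite ffunE tpermL.
have := card_matchings_supset_succ (graph_of_matching s) ts.
by rewrite cards1 subn1 => <-; apply: eq_card => S; rewrite !inE sub1set.
Qed.

(** * Information carried by short messages *)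

(** In logarithms: [ln r! / r] does not decrease with [r]. Hence fixing a fraction of the values of
    a permutation removes at least that fraction of its entropy. *)
Lemma fact_expn_le n r : (r <= n)%N -> (r`! ^ n <= n`! ^ r)%N.
Proof.
elim: n => [|n IH]; first by rewrite leqn0 => /eqP ->.
rewrite leq_eqVlt => /orP[/eqP->//|]; rewrite ltnS => rn.
rewrite expnSr factS expnMn mulnC leq_mul ?IH //.
have h m : (m`! <= n.+1 ^ m)%N || (n.+1 < m)%N.
  elim: m => // m /orP[h|h]; last by rewrite (ltn_trans h) ?orbT.
  rewrite factS expnS; case: leqP => [mn|]; last by rewrite orbT.
  by rewrite orbF leq_mul.
by have := h r; rewrite ltnNge (leq_trans rn) // orbF.
Qed.

(** The factor [i.+1] of one factorial is paired with [n - i] of the other; each such product is at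
    least [n]. *)
Lemma expn_le_fact_sqr n : (n ^ n <= n`! ^ 2)%N.
Proof.
have e : n`! = (\prod_(i < n) i.+1)%N.
  by rewrite fact_prod big_add1 /= big_mkord.
have -> : (n`! ^ 2 = \prod_(i < n) (i.+1 * (n - i)))%N.
  rewrite big_split /= -e -mulnn; congr (_ * _)%N.
  rewrite e (reindex_inj rev_ord_inj) /=.
  by apply: eq_bigr => i _; rewrite subnSK.
rewrite -[X in (n ^ X)%N](card_ord n) -prod_nat_const.
apply: leq_prod => i _; case: i => i /= lin.
have [d ->] : exists d, n = (i + d.+1)%N by exists (n - i).-1; lia.
by rewrite addKn; nia.
Qed.

(** The exact count is [2 ^ r.+1 - 1]. The cruder bound has a logarithm proportional to [r], without
    an additive constant, even at [r = 0]. *)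
Lemma card_bool_bseq_le r : (#|{: r.-bseq bool}| <= 4 ^ r)%N.
Proof.
rewrite card_bseq card_bool.
suff -> : (\sum_(i < r.+1) 2 ^ i = (2 ^ r.+1).-1)%N.
  rewrite (_ : 4 = 2 ^ 2)%N // -expnM; case: r => // r.
  by apply: leq_trans (leq_pred _) _; rewrite leq_exp2l //; lia.
elim: r => [|r IH]; first by rewrite big_ord_recl big_ord0.
by rewrite big_ord_recr IH /= [in RHS]expnS; have := expn_gt0 2 r.+1; lia.
Qed.

Section Knowledge.
Variables (T B : finType) (M : {set {set T}}) (e : {set T} -> B).

Definition known (b : B) : {set T} :=
  \bigcap_(S in M | e S == b) S.

Lemma known_sub S : S \in M -> known (e S) \subset S.
Proof. by move=> SM; apply: bigcap_inf; rewrite SM eqxx. Qed.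

(* With N_b the number of S in M with message b, the hypothesis bounds
   |known b| by n (ln |M| - ln N_b) / ln |M|; averaged over M this is at most n / ln |M|
   times the entropy of the message. *)
Lemma sum_known_le (n : nat) :
  (0 < #|M|)%N ->
  (forall b, (0 < #|[set S in M | e S == b]|)%N ->
     #|known b|%:R * ln #|M|%:R
       <= n%:R * (ln #|M|%:R - ln #|[set S in M | e S == b]|%:R)) ->
  (\sum_(S in M) #|known (e S)|)%N%:R * ln #|M|%:R
    <= n%:R * #|M|%:R * ln #|B|%:R.
Proof.
move=> M0 hyp; have [S0 S0M] : exists S, S \in M by apply/card_gt0P.
have B0 : 0 < #|B|%:R :> R by rewrite ltr0n; apply/card_gt0P; exists (e S0).
have M0' : 0 < #|M|%:R :> R by rewrite ltr0n.
pose N b := #|[set S in M | e S == b]|.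
have sumN : (\sum_b N b)%N = #|M|.
  rewrite -sum1_card (partition_big e predT) //=; apply: eq_bigr => b _.
  by rewrite /N -sum1_card; apply: eq_bigl => S; rewrite inE.
have -> : (\sum_(S in M) #|known (e S)| = \sum_b N b * #|known b|)%N.
  rewrite (partition_big e predT) //=; apply: eq_bigr => b _.
  rewrite (eq_bigr (fun=> #|known b|)) => [|S /andP[_ /eqP->]//].
  rewrite sum_nat_const; congr (_ * _)%N.
  by apply: eq_card => S; rewrite inE.
rewrite natr_sum mulr_suml.
(* The last bracket comes from [ln z <= z - 1] at z = |M| / (N_b |B|), and it cancels in the sum
   over [b]; this proves that the entropy of the message is at most [ln #|B|]. *)
have h b : (N b * #|known b|)%N%:R * ln #|M|%:R
    <= n%:R * ((N b)%:R * ln #|B|%:R + (#|M|%:R / #|B|%:R - (N b)%:R)).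
  have [Nb|Nb] := posnP (N b).
    rewrite Nb mul0n !mul0r add0r subr0 mulr_ge0 ?ler0n //.
    by rewrite divr_ge0 ?ler0n.
  have Nb' : 0 < (N b)%:R :> R by rewrite ltr0n.
  have h1 := hyp b Nb; rewrite -/(N b) in h1.
  have : ln (#|M|%:R / ((N b)%:R * #|B|%:R))%R
      <= #|M|%:R / ((N b)%:R * #|B|%:R) - 1.
    by rewrite ln_le_subr1 // divr_gt0 // mulr_gt0.
  rewrite lnM ?invr_gt0 ?mulr_gt0 // lnV ?mulr_gt0 // lnM // => h2.
  rewrite natrM -mulrA; apply: (le_trans (ler_wpM2l (ltW Nb') h1)).
  rewrite mulrCA ler_wpM2l ?ler0n //.
  have -> : #|M|%:R / #|B|%:R = (N b)%:R * (#|M|%:R / ((N b)%:R * #|B|%:R)) :> R.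
    by field; rewrite !gt_eqF.
  set Q := _ / _ in h2 *.
  rewrite (_ : _ + (_ - _) = (N b)%:R * (ln #|B|%:R + (Q - 1))); last by ring.
  by apply: ler_wpM2l; [exact: ltW|lra].
apply: (le_trans (ler_sum _ (fun b _ => h b))).
rewrite -mulr_sumr big_split /= sumrB -mulr_suml -natr_sum sumN.
rewrite sumr_const -(mulr_natr (_ / _)) divfK ?gt_eqF // subrr addr0.
by rewrite mulrA.
Qed.

End Knowledge.

Lemma ln2_gt0 : 0 < ln 2%:R.
Proof.
by rewrite -ln1; apply/RltP/ln_increasing; apply/RltP;
  rewrite ?ltr01 // (ltr_nat R 1 2).
Qed.

(** The matchings sharing a message all contain its known part, so counting the supersets of that
    part and [fact_expn_le] give the hypothesis of [sum_known_le]. The constant 4 combines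
    [ln #|B| <= 2 L ln 2] with [n ln n <= 2 ln #|M|]. The latter needs [1 < m]: a unary relation has
    a single matching, known without any message. *)
Lemma sum_known_matchings_le n m (r : nat) (L : R)
    (e : {set {ffun 'I_m -> 'I_n}} -> r.-bseq bool) :
  (1 < m)%N -> (1 < n)%N -> r%:R <= L ->
  (\sum_(S in all_matchings n m) #|known (all_matchings n m) e (e S)|)%N%:R
    <= (4 * (L * ln 2%:R) / (n%:R * ln n%:R)) * n%:R * #|all_matchings n m|%:R.
Proof.
move=> m1 n1 rL; have m0 : (0 < m)%N by apply: leq_trans m1.
set M := all_matchings n m; have cM := card_all_matchings n m0.
have M0 : (0 < #|M|)%N by rewrite cM expn_gt0 fact_gt0.
have n0 : 0 < n%:R :> R by rewrite ltr0n (leq_trans _ n1).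
have ln20 := ln2_gt0.
have lnn : 0 < ln n%:R by apply: (lt_le_trans ln20); rewrite ler_ln ?ltr0n ?ler_nat.
have f0 q : 0 < q`!%:R :> R by rewrite ltr0n fact_gt0.
have lnM' : ln #|M|%:R = m.-1%:R * ln n`!%:R by rewrite cM natrX lnX.
have lnfact : n%:R * ln n%:R <= 2 * ln n`!%:R.
  rewrite -!lnX // -!natrX ler_ln ?ltr0n ?expn_gt0 ?ler_nat //; last exact: expn_le_fact_sqr.
  by rewrite (leq_trans _ n1).
have nln0 : 0 < n%:R * ln n%:R by rewrite mulr_gt0.
have lnf0 : 0 < ln n`!%:R by move: lnfact nln0; set y := n%:R * _; lra.
have lnM2 : n%:R * ln n%:R <= 2 * ln #|M|%:R.
  apply: (le_trans lnfact); rewrite ler_wpM2l ?ler0n // lnM' ler_peMl ?(ltW lnf0) //.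
  by rewrite ler1n; lia.
have lnB : ln #|{: r.-bseq bool}|%:R <= 2 * (L * ln 2%:R).
  have : ln #|{: r.-bseq bool}|%:R <= ln (4 ^ r)%N%:R.
    rewrite ler_ln ?ler_nat ?card_bool_bseq_le // ltr0n.
    by apply/card_gt0P; exists [bseq].
  move=> h; apply: (le_trans h).
  rewrite (_ : 4 = 2 ^ 2)%N // -expnM natrX lnX ?ltr0n // natrM -mulrA.
  by rewrite ler_wpM2l ?ler0n // ler_wpM2r // ltW.
have h := @sum_known_le _ _ M e n M0 _.
have {}h : (\sum_(S in M) #|known M e (e S)|)%N%:R * ln #|M|%:R
    <= n%:R * #|M|%:R * ln #|{: r.-bseq bool}|%:R.
  apply: h => b; set Cb := [set S in M | e S == b] => Cb0.
  have [S0] : exists S, S \in Cb by apply/card_gt0P.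
  rewrite inE => /andP[S0M /eqP eS0].
  have KS0 : known M e b \subset S0 by rewrite -eS0 known_sub.
  have mS0 : is_matching S0 by move: S0M; rewrite inE.
  have Kn : (#|known M e b| <= n)%N.
    have /andP[/eqP cS0 _] := mS0.
    by rewrite (leq_trans (subset_leq_card KS0)) ?cS0.
  have CbK : (#|Cb| <= (n - #|known M e b|)`! ^ m.-1)%N.
    rewrite -(card_matchings_supset m0 mS0 KS0); apply: subset_leq_card.
    apply/subsetP => S; rewrite !inE => /andP[mS /eqP eS].
    by rewrite mS /= -eS known_sub // inE.
  have lnCb : ln #|Cb|%:R <= m.-1%:R * ln (n - #|known M e b|)`!%:R.
    by rewrite -lnX // -natrX ler_ln ?ltr0n // ler_nat.
  have lnr : n%:R * ln (n - #|known M e b|)`!%:R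
      <= (n - #|known M e b|)%:R * ln n`!%:R.
    rewrite -!lnX // -!natrX ler_ln ?ltr0n ?expn_gt0 ?fact_gt0 // ler_nat.
    by rewrite fact_expn_le // leq_subr.
  have : n%:R * ln #|Cb|%:R <= m.-1%:R * ((n - #|known M e b|)%:R * ln n`!%:R).
    apply: (le_trans (ler_wpM2l (ltW n0) lnCb)); rewrite mulrCA.
    by rewrite ler_wpM2l ?ler0n.
  by rewrite natrB // mulrCA -lnM' mulrBr mulrBl; lra.
have lnM0 : 0 < ln #|M|%:R by rewrite lnM' mulr_gt0 // ltr0n; lia.
rewrite -ler_pdivlMr // in h; apply: (le_trans h).
rewrite ler_pdivrMr //.
have nM0 : 0 <= n%:R * #|M|%:R :> R by rewrite mulr_ge0 ?ler0n.
apply: (le_trans (ler_wpM2l nM0 lnB)).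
set Y := L * _; set A := _ * ln n%:R in lnM2 nln0 *; set H := ln _ in lnM2 lnM0 *.
rewrite (_ : _ * H = n%:R * #|M|%:R * (4 * Y / A * H)); last by ring.
rewrite ler_wpM2l //.
have Y0 : 0 <= Y by rewrite mulr_ge0 ?(ltW ln20) // (le_trans _ rL) ?ler0n.
have -> : 4 * Y / A * H = 2 * Y * (2 * H / A) by field; rewrite gt_eqF.
have Y20 : 0 <= 2 * Y by exact: mulr_ge0.
by rewrite ler_peMr // ler_pdivlMr // mul1r.
Qed.

(** * One-round algorithms *)

(** Distributivity for factors whose types depend on the index, reduced to the non-dependent case by
    tagging values with their index. *)
Lemma sum_dffun_prod (F : comNzRingType) (I : finType) (T : I -> finType)
    (f : forall i, T i -> F) :
  \sum_(g : {dffun forall i, T i}) \prod_i f i (g i)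
    = \prod_i \sum_(y : T i) f i y.
Proof.
rewrite (reindex (@dffun_of_fprod I T)); last first.
  exact/onW_bij/(Bijective (@dffun_of_fprodK I T) (@fprod_of_dffunK I T)).
rewrite (eq_bigr _ (fun i _ => big_tag f i)).
rewrite (bigA_distr_big_dep (fun i => [in tagged_with T i])).
transitivity (\sum_(t : fprod T) \prod_(i in I) [ffun y => f i y] (t i)).
  by apply: eq_bigr => t _; apply: eq_bigr => i _; rewrite !ffunE.
rewrite big_fprod; apply: eq_bigr => g _; apply: eq_bigr => i _.
by rewrite /untag; case: eqP => // e; rewrite ffunE.
Qed.

(** The [k - m] coordinates outside the image of [y] are free; the others are forced. *)
Lemma card_fiber (m k n : nat) (y : 'I_m -> 'I_k) (s : {ffun 'I_m -> 'I_n}) :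
  injective y ->
  #|[set t : {ffun 'I_k -> 'I_n} | [ffun c => t (y c)] == s]| = (n ^ (k - m))%N.
Proof.
move=> yI.
pose Fam (i : 'I_k) : pred 'I_n := [pred v | [forall c, (y c == i) ==> (v == s c)]].
have -> : #|[set t : {ffun 'I_k -> 'I_n} | [ffun c => t (y c)] == s]|
    = #|(family Fam : simpl_pred {ffun 'I_k -> 'I_n})|.
  apply: eq_card => t; rewrite inE; apply/eqP/familyP => [e i|h].
    by apply/forallP => c; apply/implyP => /eqP <-; rewrite -e ffunE.
  apply/ffunP => c; rewrite ffunE; apply/eqP.
  by have /forallP/(_ c)/implyP := h (y c); apply.
rewrite card_family foldrE big_image /=.
rewrite (eq_bigr (fun i => if i \notin codom y then n else 1)%N) => [|i _].
  rewrite -big_mkcond /= (eq_bigl [in [predC codom y]]) // prod_nat_const.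
  rewrite -[#|_|](addKn #|codom y|) cardC card_ord.
  by rewrite card_codom // card_ord.
case: ifPn => [ni|]; last first.
  rewrite negbK => /codomP[c ->].
  rewrite -[RHS](card1 (s c)); apply: eq_card => v; rewrite !inE.
  apply/forallP/eqP => [/(_ c)|-> c']; first by rewrite eqxx => /eqP.
  by apply/implyP => /eqP/yI ->.
rewrite -[RHS]card_ord; apply: eq_card => v; rewrite !inE.
apply/forallP => c; apply/implyP => /eqP e.
by move: ni; rewrite -e codom_f.
Qed.

Lemma sum_proj (m k n : nat) (y : 'I_m -> 'I_k) (f : {ffun 'I_m -> 'I_n} -> R) :
  injective y ->
  \sum_(t : {ffun 'I_k -> 'I_n}) f [ffun c => t (y c)]
    = (n ^ (k - m))%N%:R * \sum_s f s.
Proof.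
move=> yI.
rewrite (partition_big (fun t : {ffun 'I_k -> 'I_n} => [ffun c => t (y c)]) predT) //=.
rewrite mulr_sumr; apply: eq_bigr => s _.
rewrite (eq_bigr (fun=> f s)) => [|t /eqP->//].
rewrite sumr_const -(card_fiber s yI) mulr_natl; congr (_ *+ _).
by apply: eq_card => t; rewrite inE.
Qed.

Lemma leq_inj_ord (m k : nat) (y : 'I_m -> 'I_k) : injective y -> (m <= k)%N.
Proof. by move=> /leq_card; rewrite !card_ord. Qed.

Section Query.
Variables (k l : nat) (a : 'I_l -> nat) (x : forall j : 'I_l, 'I_(a j) -> 'I_k).
Arguments x : clear implicits.
Variables (tau : R).
Hypothesis x_inj : distinct_atom_vars x.
Hypothesis tauP : is_tau_star x tau.

Lemma tau_star_ge0 : 0 <= tau.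
Proof. by have [[v [[v0 _] <-]] _] := tauP; apply: sumr_ge0. Qed.

(** An atom without variables could not be covered, since an empty sum is not at least 1. *)
Lemma arity_gt0 j : (0 < a j)%N.
Proof.
have [[v [[_ /(_ j) h] _]] _] := tauP; rewrite lt0n; apply/negP => /eqP aj.
move: h; rewrite big1 ?lt_geF // => i /imsetP[c].
by have := ltn_ord c; rewrite [X in (_ < X)%N]aj.
Qed.

Section Fixed.
Variable n : nat.

Definition proj (t : {ffun 'I_k -> 'I_n}) j : {ffun 'I_(a j) -> 'I_n} :=
  [ffun i => t (x j i)].

(* Raising each weight to at least d makes the powers of [friedgut] genuine
   (Rpower 0 u is a junk value) and at most doubles the means. *)
Lemma sum_prod_proj_le (w : forall j, {ffun 'I_(a j) -> 'I_n} -> R) (d : R) :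
  (0 < n)%N -> 0 < d -> d <= 1 ->
  (forall j t, 0 <= w j t) -> (forall j t, w j t <= 1) ->
  (forall j, \sum_t w j t <= d * (n ^ a j)%N%:R) ->
  \sum_t \prod_j w j (proj t j) <= (n ^ k)%N%:R * Rpower (2 * d)%R tau.
Proof.
move=> n0 d0 d1 w0 w1 wd.
have [u [u0 u1 utau]] := tau_star_edge_packing tauP.
have ule1 j : u j <= 1.
  pose i' := x j (Ordinal (arity_gt0 j)).
  apply: le_trans (u1 i'); rewrite (bigD1 j) /=; last exact: imset_f.
  by rewrite lerDl sumr_ge0.
pose G j t := Num.max (w j (proj t j)) d.
have Gd j t : d <= G j t by rewrite le_max lexx orbT.
have G0 j t : 0 < G j t by exact: lt_le_trans (Gd j t).
have G1 j t : G j t <= 1 by rewrite ge_max w1.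
have nk0 : 0 < (n ^ k)%N%:R :> R by rewrite ltr0n expn_gt0 n0.
(* Both [G j t] and [u j] are at most 1, so [w <= G <= Rpower G u]. *)
apply: (@le_trans _ _ (\sum_t \prod_j Rpower (G j t) (u j))).
  apply: ler_sum => t _; apply: ler_prod => j _; rewrite w0 /=.
  by apply: le_trans (Rpower_ge_base (G0 j t) (G1 j t) (ule1 j)); rewrite le_max lexx.
apply: (le_trans (friedgut u0 u1 G0 _)).
  move=> j i ij t v; rewrite /G; congr (Num.max (w j _) _).
  apply/ffunP => c; rewrite !ffunE; case: eqP => // e.
  by rewrite -e imset_f in ij.
rewrite ler_wpM2l ?ler0n // -utau -prod_Rpower; apply: ler_prod => j _.
rewrite (ltW (Rpower_gt0 _ _)) /=; apply: ler_Rpower => //.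
  rewrite divr_gt0 //; apply: (@lt_le_trans _ _ (\sum_(t : {ffun 'I_k -> 'I_n}) d)).
    by rewrite sumr_const card_ffun !card_ord -mulr_natr mulr_gt0.
  by apply: ler_sum.
rewrite ler_pdivrMr //.
apply: (@le_trans _ _ (\sum_t (w j (proj t j) + d))).
  by apply: ler_sum => t _; rewrite ge_max lerDl lerDr (ltW d0) w0.
rewrite big_split /= (sum_proj (w j) (@x_inj j)) sumr_const card_ffun !card_ord.
rewrite -(mulr_natr d).
have -> : 2 * d * (n ^ k)%N%:R = d * (n ^ k)%N%:R + d * (n ^ k)%N%:R by ring.
rewrite lerD2r.
have -> : (n ^ k)%N%:R = (n ^ (k - a j))%N%:R * (n ^ a j)%N%:R :> R.
  by rewrite -natrM -expnD subnK // (leq_inj_ord (@x_inj j)).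
by rewrite [leRHS]mulrCA ler_wpM2l ?ler0n.
Qed.

(** This is the independence of the relations: the indicator of [matching_db] is itself a product
    over the atoms. *)
Lemma sum_matching_db_prod (F : forall j, {set {ffun 'I_(a j) -> 'I_n}} -> R) :
  \sum_(I : database a n | matching_db I) \prod_j F j (I j)
    = \prod_j \sum_(S in all_matchings n (a j)) F j S.
Proof.
rewrite big_mkcond /=.
under [RHS]eq_bigr do rewrite big_mkcond /=.
rewrite -sum_dffun_prod; apply: eq_bigr => I _.
case: ifP => [/forallP h|/negbT].
  by apply: eq_bigr => j _; rewrite inE h.
rewrite negb_forall => /existsP[j nj].
by apply/esym/eqP; rewrite prodf_seq_eq0; apply/hasP; exists j;
  rewrite ?mem_index_enum //= inE (negbTE nj).
Qed.

Lemma prodr_nat_forall (J : finType) (b : pred J) :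
  \prod_j (b j)%:R = ([forall j, b j] : nat)%:R :> R.
Proof.
case: forallP => [h|h]; first by rewrite big1 // => j _; rewrite h.
apply/eqP; rewrite prodf_seq_eq0.
have : ~~ [forall j, b j] by apply/negP => /forallP.
rewrite negb_forall => /existsP[j nj]; apply/hasP; exists j.
  by rewrite mem_index_enum.
by rewrite (negbTE nj) /=.
Qed.

Lemma card_answersE (I : database a n) :
  #|answers x I|%:R = \sum_t \prod_j (proj t j \in I j)%:R :> R.
Proof.
rewrite -sum1_card natr_sum big_mkcond /=; apply: eq_bigr => t _.
by rewrite inE /proj prodr_nat_forall; case: [forall j, _].
Qed.

Lemma card_mem_matchings j (t : {ffun 'I_(a j) -> 'I_n}) :
  \sum_(S in all_matchings n (a j)) (t \in S)%:R
    = (n.-1`! ^ (a j).-1)%N%:R :> R.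
Proof.
rewrite -(card_matchings_mem t (arity_gt0 j)) -sum1_card natr_sum.
rewrite big_mkcond [RHS]big_mkcond; apply: eq_bigr => S _; rewrite !inE.
by case: (is_matching S); case: (t \in S).
Qed.

(** By independence, each of the [n ^ k] candidate tuples is an answer on the same number of
    matching databases. *)
Lemma sum_answers :
  (\sum_(I : database a n | matching_db I) #|answers x I|)%N%:R
    = (n ^ k)%N%:R * \prod_j (n.-1`! ^ (a j).-1)%N%:R :> R.
Proof.
rewrite natr_sum (eq_bigr _ (fun I _ => card_answersE I)) exchange_big /=.
rewrite (eq_bigr (fun=> \prod_j (n.-1`! ^ (a j).-1)%N%:R)) => [|t _].
  by rewrite sumr_const card_ffun !card_ord mulr_natl.
rewrite (sum_matching_db_prod (fun j S => (proj t j \in S)%:R)).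
by apply: eq_bigr => j _; rewrite card_mem_matchings.
Qed.

Variables (p : nat) (A : mpc1_alg k a n p).
Hypothesis A_sound : sound x A.

(** Gives messages a finite codomain, as counting requires. Messages longer than [r] collapse to a
    default value, so [encode] is faithful only on short ones. *)
Definition encode (r : nat) (s : 'I_p) (j : 'I_l) (S : {set {ffun 'I_(a j) -> 'I_n}}) :
  r.-bseq bool := insub_bseq r (msg A s S).

Lemma encode_inj r s j (S S' : {set {ffun 'I_(a j) -> 'I_n}}) :
  (size (msg A s S) <= r)%N -> (size (msg A s S') <= r)%N ->
  encode r s S = encode r s S' -> msg A s S = msg A s S'.
Proof.
move=> h h' /(congr1 val).
by rewrite /encode /insub_bseq !val_insubd h h'.
Qed.

(* Soundness lets one relation be replaced by any other matching with the same message. *)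
Lemma out_known r s (I : database a n) t :
  (forall j S, is_matching S -> (size (msg A (j := j) s S) <= r)%N) ->
  matching_db I -> t \in out A s (received A I s) ->
  forall j, proj t j \in known (all_matchings n (a j)) (encode r s (j := j))
                               (encode r s (I j)).
Proof.
move=> hr /forallP mI tout j; apply/bigcapP => S /andP[]; rewrite inE => mS /eqP eS.
pose I' : database a n := finfun (dfwith I S).
have rI' : received A I' s = received A I s.
  apply: functional_extensionality => j'; rewrite /received ffunE.
  have [<-|jj'] := eqVneq j j'; last by rewrite dfwith_out.
  by rewrite dfwith_in; apply: encode_inj eS; exact: hr.
have : t \in reported A I'.
  by apply/bigcupP; exists s => //; rewrite rI'.
move=> /(subsetP (A_sound I')); rewrite inE => /forallP/(_ j).
by rewrite ffunE dfwith_in.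
Qed.

(** Divided by the number of matchings, this is the probability that [t] is forced into S_j by its
    message to worker [s]. *)
Definition known_weight r s j (t : {ffun 'I_(a j) -> 'I_n}) : R :=
  (\sum_(S in all_matchings n (a j))
     (t \in known (all_matchings n (a j)) (encode r s (j := j))
                  (encode r s S))%:R)%R.

(** A union bound over workers: by [out_known], a worker outputs only tuples all of whose
    projections it knows. Independence then factors the sum over databases. *)
Lemma sum_correct_le r :
  (forall s j S, is_matching S -> (size (msg A (j := j) s S) <= r)%N) ->
  (\sum_(I : database a n | matching_db I) #|reported A I :&: answers x I|)%N%:R
    <= \sum_s \sum_t \prod_j known_weight r s (proj t j).
Proof.
move=> hr.
pose K s (I : database a n) j := known (all_matchings n (a j))
  (encode r s (j := j)) (encode r s (I j)).
have -> : \sum_s \sum_t \prod_j known_weight r s (proj t j) =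
    \sum_(I : database a n | matching_db I) \sum_s \sum_t
       \prod_j (proj t j \in K s I j)%:R.
  rewrite [RHS]exchange_big /=; apply: eq_bigr => s _.
  rewrite [RHS]exchange_big /=; apply: eq_bigr => t _.
  exact/esym/(sum_matching_db_prod (fun j S => (proj t j \in
    known (all_matchings n (a j)) (encode r s (j := j)) (encode r s S))%:R)).
rewrite natr_sum; apply: ler_sum => I mI.
have h : (#|reported A I :&: answers x I|
    <= \sum_s \sum_t [forall j, proj t j \in K s I j])%N.
  rewrite exchange_big /= -sum1_card big_mkcond /=; apply: leq_sum => t _.
  case: ifP => //; rewrite inE => /andP[/bigcupP[s _ tout] _].
  rewrite (bigD1 s) //= (_ : [forall j, _]) //.
  by apply/forallP; exact: out_known (hr s) mI tout.
rewrite -(ler_nat R) in h; apply: (le_trans h).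
rewrite natr_sum; apply: ler_sum => s _.
rewrite natr_sum; apply: ler_sum => t _.
by rewrite prodr_nat_forall.
Qed.

End Fixed.
End Query.

(** * * The load bound and the final estimate *)

Lemma log2_ln2 n : log2 n * ln 2%:R = ln n%:R.
Proof. by rewrite /log2 INRE RdivE divfK // gt_eqF // ln2_gt0. Qed.

(** The leading [p] counts the workers and accounts for the [- 1] in the exponent. *)
Lemma rate_eq (p tau eps D : R) : 0 < p -> 0 < D ->
  p * Rpower (D / Rpower p (1 - eps))%R tau
    = Rpower D tau / Rpower p (tau * (1 - eps) - 1).
Proof.
move=> p0 D0; rewrite !RminusE RmultE !R1E.
rewrite RpowerM ?invr_gt0 ?Rpower_gt0 // RpowerV ?Rpower_gt0 //.
rewrite Rpower_powM RpowerD RpowerN Rpower1 // invfM invrK mulrCA.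
by rewrite [(1 - eps) * tau]mulrC [p * _]mulrC.
Qed.

Lemma expected_answers_ge0 (k l : nat) (a : 'I_l -> nat)
    (x : forall j : 'I_l, 'I_(a j) -> 'I_k) n : 0 <= expected_answers x n.
Proof. by rewrite divr_ge0 ?ler0n. Qed.

Lemma expected_correct_le (k l : nat) (a : 'I_l -> nat)
    (x : forall j : 'I_l, 'I_(a j) -> 'I_k) n p (A : mpc1_alg k a n p) :
  expected_correct x A <= expected_answers x n.
Proof.
rewrite ler_wpM2r ?invr_ge0 ?ler0n // ler_nat; apply: leq_sum => I _.
exact: subset_leq_card (subsetIr _ _).
Qed.

Section Load.
Variables (k l : nat) (a : 'I_l -> nat) (x : forall j : 'I_l, 'I_(a j) -> 'I_k).
Variables (n p : nat) (c eps : R) (A : mpc1_alg k a n p).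
Hypothesis A_load : load_ok c eps A.

(* The load bound, applied to the database whose other relations are empty. *)
Lemma size_msg_le s j (S : {set {ffun 'I_(a j) -> 'I_n}}) :
  (size (msg A s S))%:R
    <= c * ((#|S| * a j)%N%:R * log2 n) / Rpower p%:R (1 - eps).
Proof.
pose I : database a n := finfun (dfwith (fun=> set0) S).
have IE : input_bits I = (#|S| * a j)%N%:R * log2 n.
  rewrite /input_bits (bigD1 j) //= big1 => [|j' jj'].
    by rewrite ffunE dfwith_in addr0.
  by rewrite ffunE dfwith_out 1?eq_sym // cards0 mul0r.
rewrite -IE; apply: le_trans (A_load I s); rewrite ler_nat.
by rewrite (bigD1 j) //= /received ffunE dfwith_in leq_addr.
Qed.

(* Without bits a worker answers as on the empty database, hence not at all. *)
Lemma expected_correct_eq0 :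
  (0 < l)%N -> (n <= 1)%N -> sound x A -> expected_correct x A = 0.
Proof.
move=> l0 n1 A_sound.
(* At [n = 0] this rests on the default value 0 of [ln] outside the positive reals. *)
have log0 : log2 n = 0.
  rewrite /log2 INRE RdivE (_ : ln _ = 0) ?mul0r //.
  case: n n1 => [|[|]] // _; last exact: ln1.
  by rewrite /ln; case: Rlt_dec => // h; case: (Rlt_irrefl _ h).
have msg0 s j (S : {set {ffun 'I_(a j) -> 'I_n}}) : msg A s S = [::].
  apply/eqP; rewrite -size_eq0 -leqn0 -(ler_nat R).
  by apply: (le_trans (size_msg_le s S)); rewrite log0 !mulr0 mul0r.
rewrite /expected_correct /E_matching RdivE big1 ?mul0r // => I _.
apply/eqP; rewrite cards_eq0 -subset0; apply/subsetP => t.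
rewrite inE => /andP[/bigcupP[s _ tout] _].
pose I0 : database a n := finfun (fun=> set0).
have : t \in reported A I0.
  apply/bigcupP; exists s => //.
  rewrite (_ : received A I0 s = received A I s) //.
  by apply: functional_extensionality => j; rewrite /received !msg0.
move=> /(subsetP (A_sound I0)); rewrite inE => /forallP/(_ (Ordinal l0)).
by rewrite [finfun _ _]ffunE inE.
Qed.

End Load.

(** Both sides count the pairs of a matching and a tuple in it. This converts the bound on known
    tuples into a bound on the mean of the normalised weights. *)
Lemma fact_expn_pred n m : (0 < n)%N -> (0 < m)%N ->
  (n * n`! ^ m.-1 = n ^ m * n.-1`! ^ m.-1)%N.
Proof. by case: n m => [|n] [|m] //= _ _; rewrite factS expnMn mulnA -expnS. Qed.

Lemma expected_correct_rate (k l : nat) (a : 'I_l -> nat)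
    (x : forall j : 'I_l, 'I_(a j) -> 'I_k) (tau c eps d : R) (n p : nat)
    (A : mpc1_alg k a n p) :
  no_unary_atoms a -> distinct_atom_vars x -> is_tau_star x tau ->
  (1 < n)%N -> 0 < c ->
  d = 4 * c * (\sum_j a j)%N%:R / Rpower p%:R (1 - eps) -> 0 < d -> d <= 1 ->
  load_ok c eps A -> sound x A ->
  expected_correct x A <= p%:R * Rpower (2 * d)%R tau * expected_answers x n.
Proof.
move=> nu xI tP n1 c0 dE d0 d1 A_load A_sound.
have n0 : (0 < n)%N by exact: leq_trans n1.
rewrite /expected_correct /expected_answers /E_matching !RdivE mulrA.
rewrite ler_wpM2r ?invr_ge0 ?ler0n //.
have a1 j : (1 < a j)%N.
  have := arity_gt0 tP j; have := nu j.
  by case: (a j) => [|[|]].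
set P := Rpower p%:R (1 - eps) in dE *.
have P0 : 0 < P := Rpower_gt0 _ _.
(* The load allowed on a matching database; it bounds the messages of all atoms uniformly. *)
pose L := c * ((n * \sum_j a j)%N%:R * log2 n) / P.
have ln20 := ln2_gt0.
have lnn : 0 < ln n%:R.
  by apply: (lt_le_trans ln20); rewrite ler_ln ?ltr0n ?ler_nat.
have log20 : 0 <= log2 n by rewrite -(pmulr_lge0 _ ln20) log2_ln2 ltW.
have L0 : 0 <= L.
  by rewrite divr_ge0 ?(ltW P0) // mulr_ge0 ?(ltW c0) // mulr_ge0 ?ler0n.
pose r := Num.truncn L.
have rL : r%:R <= L by rewrite truncn_le.
have hr s j (S : {set {ffun 'I_(a j) -> 'I_n}}) :
    is_matching S -> (size (msg A s S) <= r)%N.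
  move=> /andP[/eqP cS _]; rewrite truncn_ge_nat //.
  apply: (le_trans (size_msg_le A_load s S)).
  rewrite /L -/P ler_wpM2r ?invr_ge0 ?(ltW P0) // ler_wpM2l ?(ltW c0) //.
  rewrite ler_wpM2r // ler_nat cS leq_mul2l (bigD1 j) //= leq_addr orbT //.
(* The factor [n ln n] cancels, which explains the form of [d]. *)
have LE : 4 * (L * ln 2%:R) / (n%:R * ln n%:R) = d.
  rewrite dE /L.
  have -> : c * ((n * \sum_j a j)%N%:R * log2 n) / P * ln 2%:R =
    c * (n * \sum_j a j)%N%:R * (log2 n * ln 2%:R) / P by ring.
  rewrite log2_ln2 natrM; field.
  by rewrite !gt_eqF // ltr0n.
apply: (le_trans (sum_correct_le A_sound hr)).
rewrite (sum_answers tP) -mulrA -[p in p%:R * _](card_ord p) mulr_natl -sumr_const.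
apply: ler_sum => s _.
(* The number of matchings containing a given tuple. Dividing by it puts the weights in [0, 1],
   because a known tuple belongs to the relation. *)
pose dg j : R := ((n.-1`! ^ (a j).-1)%N%:R)%R.
have dg0 j : 0 < dg j by rewrite ltr0n expn_gt0 fact_gt0.
pose w j t := known_weight A r s (j := j) t / dg j.
have wE t : \prod_j known_weight A r s (proj x t j)
    = (\prod_j dg j) * \prod_j w j (proj x t j).
  rewrite -big_split /=; apply: eq_bigr => j _.
  by rewrite /w mulrC divfK // gt_eqF.
rewrite (eq_bigr _ (fun t _ => wE t)) -mulr_sumr.
rewrite [leRHS](_ : _ = (\prod_j dg j) * ((n ^ k)%N%:R * Rpower (2 * d)%R tau));
  last by rewrite -/(dg _); ring.
rewrite ler_wpM2l ?prodr_ge0 //.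
apply: (sum_prod_proj_le xI tP) => //.
- by move=> j t; rewrite divr_ge0 ?(ltW (dg0 j)) // sumr_ge0.
- move=> j t; rewrite ler_pdivrMr // mul1r /dg -(card_mem_matchings tP t).
  apply: ler_sum => S SM; rewrite ler_nat.
  case: (boolP (t \in known _ _ _)) => // tK.
  by rewrite (subsetP (known_sub _ SM) _ tK).
- move=> j; rewrite -mulr_suml ler_pdivrMr //.
  have -> : \sum_t known_weight A r s (j := j) t
      = (\sum_(S in all_matchings n (a j)) #|known (all_matchings n (a j))
           (encode A r s (j := j)) (encode A r s S)|)%N%:R.
    rewrite exchange_big natr_sum /=; apply: eq_bigr => S _.
    rewrite -sum1_card natr_sum [RHS]big_mkcond /=; apply: eq_bigr => t _.
    by case: (t \in _).
  apply: (le_trans (sum_known_matchings_le _ (a1 j) n1 rL)).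
  rewrite LE -!mulrA ler_wpM2l ?(ltW d0) // card_all_matchings ?(ltnW (a1 j)) //.
  by rewrite /dg -!natrM fact_expn_pred ?(ltnW (a1 j)).
Qed.

Theorem theorem3 (k l : nat) (a : 'I_l -> nat)
    (x : forall j : 'I_l, 'I_(a j) -> 'I_k) (tau c : R) :
  connected_query x -> no_unary_atoms a -> distinct_atom_vars x ->
  is_tau_star x tau -> 0 < c ->
  exists C : R, 0 < C /\
    forall (eps : R), eps < 1 - tau^-1 ->
    forall (n p : nat) (A : mpc1_alg k a n p),
      (0 < p)%N -> load_ok c eps A -> sound x A ->
      expected_correct x A
        <= C * expected_answers x n / Rpower p%:R (tau * (1 - eps) - 1).
Proof.
move=> _ nu xI tP c0.
have tau0 := tau_star_ge0 tP.
have Ea0 n := expected_answers_ge0 x n.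
have [l0|l0] := posnP l.
  (* Without atoms the zero cover is admissible. The claim with [C = 1] then bounds the correct
     answers by [p] times all expected answers. *)
  have t0 : tau = 0.
    apply/eqP; rewrite eq_le tau0 andbT.
    have [_ /(_ (fun=> 0))] := tP; rewrite big1 //; apply; split=> // j.
    by have := ltn_ord j; rewrite [X in (_ < X)%N]l0.
  exists 1; split=> // eps _ n p A p0 _ _.
  apply: (le_trans (expected_correct_le x A)).
  rewrite mul1r t0 RminusE RmultE mul0r sub0r RpowerN Rpower1 ?ltr0n // invrK.
  by rewrite ler_peMr // ler1n.
pose s := (\sum_j a j)%N.
have s0 : (0 < s)%N.
  by rewrite /s (bigD1 (Ordinal l0)) //= addn_gt0 (arity_gt0 tP).
(* The 8 is the 4 of the entropy bound times the 2 lost by raising the weights to at least [d]. *)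
pose D := 8 * c * s%:R.
have D0 : 0 < D by rewrite !mulr_gt0 ?ltr0n.
exists (Rpower D tau); split; first exact: Rpower_gt0.
move=> eps _ n p A p0 A_load A_sound.
have p0' : 0 < p%:R :> R by rewrite ltr0n.
rewrite mulrAC -rate_eq //.
have [n1|n1] := leqP n 1.
  rewrite (expected_correct_eq0 A_load) //.
  apply: mulr_ge0 => //; apply: mulr_ge0; first exact: ltW.
  exact: ltW (Rpower_gt0 _ _).
pose d := 4 * c * s%:R / Rpower p%:R (1 - eps).
have dE : D / Rpower p%:R (1 - eps) = 2 * d by rewrite /D /d; ring.
have d0 : 0 < d by rewrite divr_gt0 ?Rpower_gt0 // !mulr_gt0 ?ltr0n.
rewrite dE; have [d1|d1] := leP d 1.
  exact: expected_correct_rate A_load A_sound.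
(* For [d] above 1 the claimed factor is at least 1, so the trivial bound by all answers
   suffices. *)
apply: (le_trans (expected_correct_le x A)); rewrite ler_peMl //.
by rewrite mulr_ege1 ?ler1n // Rpower_ge1 //; lra.
Qed.
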